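(* Let $\phi$ be a linear CNF formula. If there exist a number $m$ and a subset of clauses $F \subseteq \phi$ such that $\phi$ is $m$-extensible with respect to $F$, then every $\mathrm{Res}(\oplus)$ refutation of $\phi$ has space at least $m$.
   Context: A linear literal is an equation $f = \alpha$, where $f$ is a linear form over $\mathbb{F}_2$ and $\alpha \in \{0,1\}$. A linear clause is a disjunction of linear literals; a linear CNF formula is a conjunction (set) of linear clauses. A linear clause $D$ is semantically implied by $C$ if every assignment satisfying $C$ satisfies $D$. $\mathrm{Res}(\oplus)$ has two rules: (Resolution) from $A \lor (f=0)$ and $B \lor (f=1)$ derive $A \lor B$; (Weakening) from $C$ derive any $D$ semantically implied by $C$. A configuration is a set of linear clauses. A $\mathrm{Res}(\oplus)$ refutation of $\phi$ (for space purposes) is a sequence of configurations $S_1,\dots,S_t$ with $S_1 = \emptyset$, $S_t$ containing the empty clause, and each $S_i$ obtained from $S_{i-1}$ by one of: download ($S_i = S_{i-1}\cup\{C\}$ with $C$ a clause of $\phi$), erasure ($S_i = S_{i-1}\setminus\{C\}$ with $C\in S_{i-1}$), inference ($S_i = S_{i-1}\cup\{C\}$ where $C$ is deduced from clauses of $S_{i-1}$ using the Resolution and Weakening rules). Its space is $\max_i |S_i|$. Let $\phi$ be a linear CNF in variables $v$ and $F \subseteq \phi$. A solution $\sigma$ of a linear system $Av=b$ over $\mathbb{F}_2$ is $F$-proper if it satisfies every clause of $F$. $\phi$ is $m$-extensible with respect to $F$ if for every linear system $Av=b$ over $\mathbb{F}_2$ in the variables $v$ with fewer than $m$ equations that has an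 $F$-proper solution, and every clause $C \in \phi\setminus F$, there exists an $F$-proper solution of $Av=b$ satisfying $C$.
   Formalization: The formal theorem additionally assumes that F is satisfiable; without this, m-extensibility is vacuous and the claim fails, e.g. for φ = F consisting of just the empty clause, which has a refutation of space 1 but is m-extensible for every m. *)

(* Defs.v *)
From HB Require Import structures.
From mathcomp Require Import all_boot all_order all_algebra.

Set Implicit Arguments.
Unset Strict Implicit.
Unset Printing Implicit Defensive.

Import GRing.Theory.

Local Open Scope ring_scope.

Definition assignment (n : nat) := 'cV['F_2]_n.

(* The literal [f = a], where the row vector [f] holds the coefficients of the
   linear form. *)
Definition literal (n : nat) := ('rV['F_2]_n * 'F_2)%type.

Definition clause (n : nat) := {set literal n}.

Definition lcnf (n : nat) := {set clause n}.

Definition config (n : nat) := {set clause n}.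

Definition sat_lit (n : nat) (v : assignment n) (l : literal n) : bool :=
  (l.1 *m v) 0 0 == l.2.

Definition sat_clause (n : nat) (v : assignment n) (C : clause n) : bool :=
  [exists l in C, sat_lit v l].

Definition implied (n : nat) (C D : clause n) : Prop :=
  forall v : assignment n, sat_clause v C -> sat_clause v D.

Definition empty_clause (n : nat) : clause n := set0.

Inductive deduced (n : nat) (S : config n) : clause n -> Prop :=
| Deduced_hyp (C : clause n) : C \in S -> deduced S C
| Deduced_resolution (A B : clause n) (f : 'rV['F_2]_n) :
    deduced S (A :|: [set (f, 0)]) -> deduced S (B :|: [set (f, 1)]) ->
    deduced S (A :|: B)
| Deduced_weakening (C D : clause n) :
    deduced S C -> implied C D -> deduced S D.

(* An inference may use any number of rule applications; refutations whose
   inferences are single rule applications are a special case. *)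
Inductive step (n : nat) (phi : lcnf n) (S : config n) : config n -> Prop :=
| Step_download (C : clause n) : C \in phi -> step phi S (S :|: [set C])
| Step_erasure (C : clause n) : C \in S -> step phi S (S :\ C)
| Step_inference (C : clause n) : deduced S C -> step phi S (S :|: [set C]).

Definition refutation (n : nat) (phi : lcnf n) (P : seq (config n)) : Prop :=
  [/\ (0 < size P)%N,
      nth set0 P 0 = set0,
      forall i : nat, (i.+1 < size P)%N ->
        step phi (nth set0 P i) (nth set0 P i.+1)
    & empty_clause n \in last set0 P].

Definition refutation_space (n : nat) (P : seq (config n)) : nat :=
  (\max_(S <- P) #|S|)%N.

Definition sat_cnf (n : nat) (v : assignment n) (F : lcnf n) : Prop :=
  forall C : clause n, C \in F -> sat_clause v C.

Definition proper_solution (n : nat) (F : lcnf n) (k : nat)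
    (A : 'M['F_2]_(k, n)) (b : 'cV['F_2]_k) (v : assignment n) : Prop :=
  A *m v = b /\ sat_cnf v F.

(* Vacuously true, for every [m], when [F] is unsatisfiable: no system then has
   an [F]-proper solution. *)
Definition extensible (n : nat) (phi : lcnf n) (m : nat) (F : lcnf n) : Prop :=
  forall (k : nat) (A : 'M['F_2]_(k, n)) (b : 'cV['F_2]_k),
    (k < m)%N ->
    (exists v : assignment n, proper_solution F A b v) ->
    forall C : clause n, C \in phi :\: F ->
      exists v : assignment n, proper_solution F A b v /\ sat_clause v C.

(* Main.v *)
Require Import Defs.
From mathcomp Require Import all_boot all_algebra.

(** Call a literal [e] a witness of a clause [D] if [e] implies [D].  As long as
the configurations have fewer than [m] clauses, one can maintain a witness for
every clause of the configuration together with an assignment that satisfies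
[F] and all the witnesses; hence the empty clause is never reached.  A
downloaded clause is satisfied by such an assignment, directly if it is in [F]
and by extensibility applied to the system of the witnesses otherwise, and any
literal of it that holds is a witness.  For an inferred clause [D], the
witnesses are inconsistent with the negation of [D], which is again a linear
system.  Some linear combination of all these equations therefore reads
[0 = 1], and the part of it that comes from the witnesses is a witness of [D]. *)

Set Implicit Arguments.
Unset Strict Implicit.
Unset Printing Implicit Defensive.

Import GRing.Theory.

Local Open Scope ring_scope.

(** Fredholm alternative: [d^T] lies outside the row space of [M^T], so some column of [cokermx M^T]
    does not annihilate it; that column, transposed, is [y]. *)
Lemma unsolvable_certificate (K : fieldType) (p n : nat)
    (M : 'M[K]_(p, n)) (d : 'cV[K]_p) :
  (forall v : 'cV[K]_n, M *m v <> d) ->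
  exists y : 'rV[K]_p, y *m M = 0 /\ (y *m d) 0 0 != 0.
Proof.
move=> unsol.
have : d^T *m cokermx M^T != 0.
  rewrite -submxE; apply/negP => /submxP[u du].
  by apply: (unsol u^T); rewrite -[LHS]trmxK trmx_mul trmxK -du trmxK.
case/matrix0Pn=> i [j]; rewrite ord1 => nz.
exists (col j (cokermx M^T))^T; split.
  by rewrite -[LHS]trmxK trmx_mul trmxK colE mulmxA mulmx_coker mul0mx trmx0.
suff -> : ((col j (cokermx M^T))^T *m d) 0 0 = (d^T *m cokermx M^T) 0 j by [].
by rewrite !mxE; apply: eq_bigr => k _; rewrite !mxE mulrC.
Qed.

Lemma F2_neq (x y : 'F_2) : (x != y) = (x == y + 1).
Proof. by case: x y => [[|[|//]] ?] [[|[|//]] ?]. Qed.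

Section LinearClauses.

Variable n : nat.

Implicit Types (v : assignment n) (C D : clause n) (S F phi : config n).

Lemma sat_clauseP v C :
  reflect (exists2 l, l \in C & sat_lit v l) (sat_clause v C).
Proof. exact: exists_inP. Qed.

Definition neg_lit (l : literal n) : literal n := (l.1, l.2 + 1).

Lemma sat_neg_lit v l : sat_lit v (neg_lit l) = ~~ sat_lit v l.
Proof. by rewrite /sat_lit F2_neq. Qed.

Definition sys_mx k (l : 'I_k -> literal n) : 'M['F_2]_(k, n) :=
  \matrix_i (l i).1.

Definition sys_rhs k (l : 'I_k -> literal n) : 'cV['F_2]_k :=
  \col_i (l i).2.

Lemma sysP k (l : 'I_k -> literal n) v :
  sys_mx l *m v = sys_rhs l <-> forall i, sat_lit v (l i).
Proof.
have rowE i : (sys_mx l *m v) i 0 = ((l i).1 *m v) 0 0.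
  by rewrite -[(l i).1](rowK (fun i => (l i).1)) -row_mul [RHS]mxE.
split=> [eq_sys i | sat_l].
  by rewrite /sat_lit -rowE eq_sys mxE.
by apply/matrixP => i j; rewrite ord1 rowE (eqP (sat_l i)) mxE.
Qed.

Lemma linear_interpolation k (l : 'I_k -> literal n) C :
  (forall v, (forall i, sat_lit v (l i)) -> sat_clause v C) ->
  exists e : literal n,
    (forall v, (forall i, sat_lit v (l i)) -> sat_lit v e) /\
    (forall v, sat_lit v e -> sat_clause v C).
Proof.
move=> l_C; pose nC (i : 'I_#|C|) := neg_lit (enum_val i).
have nCP v : ~~ sat_clause v C -> forall i, sat_lit v (nC i).
  move=> nsat i; rewrite sat_neg_lit; apply: contra nsat => sat_i.
  by apply/sat_clauseP; exists (enum_val i); rewrite ?enum_valP.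
have [v|y] := @unsolvable_certificate _ _ _ (col_mx (sys_mx l) (sys_mx nC))
    (col_mx (sys_rhs l) (sys_rhs nC)).
  rewrite mul_col_mx => /eq_col_mx[/sysP sat_l /sysP sat_nC].
  have /sat_clauseP[a aC sat_a] := l_C v sat_l.
  by have := sat_nC (enum_rank_in aC a);
     rewrite sat_neg_lit enum_rankK_in // sat_a.
rewrite -[y]hsubmxK; set u := lsubmx y; set w := rsubmx y.
rewrite !mul_row_col => -[yM yd].
(* [u] is the part of the certificate [y] acting on the equations [l], [w] the part acting on the
   negated literals of [C]. *)
exists (u *m sys_mx l, (u *m sys_rhs l) 0 0); split=> v.
  by move=> /sysP sat_l; rewrite /sat_lit -mulmxA sat_l.
(* If [e] held and [C] failed at [v], the combination [y] of the right-hand sides would equal that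
   of the left-hand sides at [v], which is 0. *)
rewrite /sat_lit /= => /eqP sat_e; apply: contraT => /nCP/sysP sat_nC.
case/eqP: yd.
rewrite mxE -sat_e -sat_nC mulmxA.
have := congr1 (fun M => (M *m v) 0 0) yM.
by rewrite mulmxDl mul0mx mxE [RHS]mxE.
Qed.

Lemma deduced_sound S C v :
  deduced S C -> (forall D, D \in S -> sat_clause v D) -> sat_clause v C.
Proof.
move=> ded sat_S; elim: ded => [D /sat_S //| A B f _ satA _ satB | D E _ satD].
  have [/sat_clauseP[a + sat_a] /sat_clauseP[b + sat_b]] := (satA, satB).
  rewrite !inE => /orP[aA _|/eqP a_f /orP[bB|/eqP b_f]].
  - by apply/sat_clauseP; exists a; rewrite // inE aA.
  - by apply/sat_clauseP; exists b; rewrite // inE bB orbT.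
  by move: sat_a sat_b; rewrite a_f b_f /sat_lit /= => /eqP->.
exact.
Qed.

(** [E] is total for convenience; only its values on [S] matter. *)
Definition witnessed F S : Prop :=
  exists v (E : clause n -> literal n), sat_cnf v F /\
    forall D, D \in S ->
      sat_lit v (E D) /\ forall w, sat_lit w (E D) -> sat_clause w D.

Lemma witnessed_add F S C v (E : clause n -> literal n) e :
  sat_cnf v F ->
  (forall D, D \in S ->
     sat_lit v (E D) /\ forall w, sat_lit w (E D) -> sat_clause w D) ->
  sat_lit v e -> (forall w, sat_lit w e -> sat_clause w C) ->
  witnessed F (S :|: [set C]).
Proof.
move=> vF vE ve eC; exists v, (fun D => if D == C then e else E D).
split=> // D; rewrite !inE; case: eqP => [-> // | _].
by rewrite orbF => /vE.
Qed.

(** The assignment may change here, while the witnesses of the clauses of [S] can be kept, since the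
    new assignment solves their system. *)
Lemma witnessed_download phi m F S C :
  extensible phi m F -> C \in phi -> (#|S :|: [set C]| < m)%N ->
  witnessed F S -> witnessed F (S :|: [set C]).
Proof.
move=> ext Cphi ltm [v [E [vF vE]]].
pose l (i : 'I_#|S|) := E (enum_val i).
have lP w : (forall i, sat_lit w (l i)) -> forall D, D \in S -> sat_lit w (E D).
  by move=> wl D DS; rewrite -(enum_rankK_in DS DS); apply: wl.
suff [w [wF wE /sat_clauseP[a aC wa]]] :
    exists w, [/\ sat_cnf w F, forall D, D \in S -> sat_lit w (E D)
                & sat_clause w C].
  apply: (@witnessed_add F S C w E a) => // [D DS | u ua].
    by split; [apply: wE | case: (vE D DS)].
  by apply/sat_clauseP; exists a.
have [CF|CF] := boolP (C \in F).
  by exists v; split=> [//|D /vE[]//|]; apply: vF.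
have [| | | w [[/sysP wl wF] wC]] := ext #|S| (sys_mx l) (sys_rhs l) _ _ C.
(* One equation per clause of [S], hence fewer than [m]. *)
- by apply: leq_ltn_trans ltm; apply/subset_leq_card/subsetUl.
- exists v; split=> //; apply/sysP => i.
  by case: (vE _ (enum_valP i)).
- by rewrite inE CF.
by exists w; split=> //; apply: lP.
Qed.

Lemma witnessed_inference F S C :
  deduced S C -> witnessed F S -> witnessed F (S :|: [set C]).
Proof.
move=> ded [v [E [vF vE]]].
pose l (i : 'I_#|S|) := E (enum_val i).
have [w wl|e [le eC]] := @linear_interpolation _ l C.
  apply: deduced_sound ded _ => D DS; have [_] := vE D DS; apply.
  by rewrite -(enum_rankK_in DS DS); apply: wl.
apply: (witnessed_add vF vE _ eC); apply: le => i.
by case: (vE _ (enum_valP i)).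
Qed.

Lemma witnessed_step phi m F S S' :
  extensible phi m F -> (#|S'| < m)%N -> step phi S S' ->
  witnessed F S -> witnessed F S'.
Proof.
move=> ext + st; case: st => [C Cphi|C _ _|C ded _].
- exact: (witnessed_download ext Cphi).
- by case=> v [E [vF vE]]; exists v, E; split=> // D /setD1P[_ /vE].
exact: witnessed_inference.
Qed.

Lemma witnessed_empty_clause F S : witnessed F S -> empty_clause n \notin S.
Proof.
case=> v [E [_ vE]]; apply/negP => /vE[vE0 /(_ v vE0)].
by case/sat_clauseP => a; rewrite inE.
Qed.

End LinearClauses.

Theorem theorem3p2 (n : nat) (phi : lcnf n) (m : nat) (F : lcnf n) :
  F \subset phi ->
  (exists v : assignment n, sat_cnf v F) ->
  extensible phi m F ->
  forall P : seq (config n), refutation phi P -> (m <= refutation_space P)%N.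
Proof.
move=> _ [v vF] ext P [P_gt0 P0 Pstep Plast]; rewrite leqNgt; apply/negP => lt_m.
have wit i : (i < size P)%N -> witnessed F (nth set0 P i).
  elim: i => [_ | i IHi lt_i].
    (* The first configuration is empty, so [(0, 0)] is an arbitrary default. *)
    by rewrite P0; exists v, (fun=> (0, 0)); split=> // D; rewrite inE.
  apply: (witnessed_step ext _ (Pstep i lt_i) (IHi (ltnW lt_i))).
  by apply: leq_ltn_trans lt_m; apply: leq_bigmax_seq => //; apply: mem_nth.
by move: Plast; rewrite -nth_last; apply/negP/witnessed_empty_clause/wit;
   rewrite ltn_predL.
Qed.
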